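(* Let $k$ be an algebraically closed field of characteristic $0$, $R=k\langle x,y\rangle/(xy-yx-y^2)$, and let $\rho:R\to \mathrm{End}(k^n)$ be any finite dimensional representation, with image algebra $A=\rho(R)$ and $J=J(A)$ the Jacobson radical of $A$. Then the semisimple part of $A$ is a product of finitely many copies of $k$: $$A/J\cong\prod_{i=1}^r k_i,\qquad k_i=k,$$ where $r$ is the number of different eigenvalues of the matrix $X=\rho(x)$. *)

(* Defs.v *)
From HB Require Import structures.
From mathcomp Require Import all_boot all_order all_algebra.
From mathcomp Require finmap.
From mathcomp Require Import boolp classical_sets.
From mathcomp.multinomials Require Import monalg.

Set Implicit Arguments.
Unset Strict Implicit.
Unset Printing Implicit Defensive.

Import GRing.Theory.
Local Open Scope classical_set_scope.
Local Open Scope ring_scope.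
Local Open Scope quotient_scope.

(* Rings are [pzRingType]s, where 1 = 0 is allowed: for the representation on
   k^0, the image algebra and its quotient by the radical are zero rings. *)

Section Ideals.
Variable A : pzRingType.

Definition left_ideal (I : set A) : Prop :=
  [/\ I 0, forall x y, I x -> I y -> I (x + y) & forall a x, I x -> I (a * x)].

Definition two_sided_ideal (I : set A) : Prop :=
  left_ideal I /\ forall a x, I x -> I (x * a).

Definition maximal_left_ideal (M : set A) : Prop :=
  [/\ left_ideal M, M <> setT &
      forall N, left_ideal N -> M `<=` N -> N = M \/ N = setT].

Definition ideal_gen (S : set A) : set A :=
  \bigcap_(I in [set I | two_sided_ideal I /\ S `<=` I]) I.

Definition jacobson_radical : set A := \bigcap_(M in maximal_left_ideal) M.

Lemma left_idealN (I : set A) : left_ideal I -> forall x, I x -> I (- x).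
Proof. by case=> _ _ IM x Ix; rewrite -mulN1r; apply: IM. Qed.

Lemma left_ideal1 (I : set A) : left_ideal I -> I 1 -> I = setT.
Proof.
case=> _ _ IM I1; apply/seteqP; split=> // x _.
by rewrite -[x]mulr1; apply: IM.
Qed.

Lemma bigcap_left_ideal (P : set (set A)) :
  P `<=` left_ideal -> left_ideal (\bigcap_(I in P) I).
Proof.
move=> PL; split=> [I PI|x y Hx Hy I PI|a x Hx I PI].
  by have [] := PL _ PI.
  by have [_ ID _] := PL _ PI; apply: ID; [apply: Hx | apply: Hy].
by have [_ _ IM] := PL _ PI; apply: IM; apply: Hx.
Qed.

Lemma ideal_gen_ideal (S : set A) : two_sided_ideal (ideal_gen S).
Proof.
split; first by apply: bigcap_left_ideal => I [[]].
by move=> a x Hx I [idI SI]; have [_ IR] := idI; apply: IR; apply: Hx.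
Qed.

Lemma maximal_left_ideal_colon (M : set A) a :
  maximal_left_ideal M -> ~ M a -> maximal_left_ideal [set x | M (x * a)].
Proof.
move=> [LM MT Mmax] Ma; have [M0 MD MM] := LM; split.
- split=> [|x y|b x] /=; first by rewrite mul0r.
    by rewrite mulrDl; apply: MD.
  by rewrite -mulrA; apply: MM.
- by move=> E; apply: Ma; rewrite -[a]mul1r -[M _]/([set x | M (x * a)] 1) E.
move=> N LN sub; have [N0 ND NM] := LN.
pose L := [set z | exists n m, [/\ N n, M m & z = n * a + m]].
have LL : left_ideal L.
  split=> [|_ _ [n [m [Nn Mm ->]]] [n' [m' [Nn' Mm' ->]]]|b _ [n [m [Nn Mm ->]]]].
  - by exists 0, 0; rewrite mul0r addr0.
  - exists (n + n'), (m + m'); split; [exact: ND|exact: MD|].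
    by rewrite mulrDl addrACA.
  - exists (b * n), (b * m); split; [exact: NM|exact: MM|].
    by rewrite mulrDr mulrA.
have ML : M `<=` L by move=> m Mm; exists 0, m; rewrite mul0r add0r.
have [LM'|LT] := Mmax _ LL ML.
  left; apply/seteqP; split=> // n Nn /=; rewrite -LM'.
  by exists n, 0; rewrite addr0.
right; apply: left_ideal1 => //.
have [n [m [Nn Mm e]]] : L a by rewrite LT.
rewrite -[1](subrK n); apply: ND => //; apply: sub => /=.
by rewrite mulrBl mul1r {1}e addrC addKr.
Qed.

Lemma jacobson_radical_ideal : two_sided_ideal jacobson_radical.
Proof.
split; first by apply: bigcap_left_ideal => M [].
move=> a x Jx M maxM; have [[_ _ MM] _ _] := maxM.
have [Ma|Ma] := pselect (M a); first exact: MM.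
exact: (Jx _ (maximal_left_ideal_colon maxM Ma)).
Qed.

End Ideals.

Arguments jacobson_radical A : clear implicits.

HB.mixin Record isTwoSided (A : pzRingType) (I : {pred A}) := {
  ideal_mull : forall a x, x \in I -> a * x \in I;
  ideal_mulr : forall a x, x \in I -> x * a \in I
}.

#[short(type="tsIdealType")]
HB.structure Definition TwoSidedIdeal (A : pzRingType) :=
  {I of GRing.ZmodClosed A I & isTwoSided A I}.

Section IdealPred.
Variables (A : pzRingType) (I : set A).
Hypothesis idI : two_sided_ideal I.

Fact two_sided_ideal_zmod_closed : zmod_closed (mem I).
Proof.
have [[I0 ID IM] _] := idI; split=> [|x y]; rewrite !inE // => Ix Iy.
by apply: ID => //; apply: left_idealN => //; case: idI.
Qed.

Fact two_sided_ideal_mull a x : x \in mem I -> a * x \in mem I.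
Proof. by have [[_ _ IM] _] := idI; rewrite !inE; apply: IM. Qed.

Fact two_sided_ideal_mulr a x : x \in mem I -> x * a \in mem I.
Proof. by have [_ IM] := idI; rewrite !inE; apply: IM. Qed.

End IdealPred.

Definition in_ideal_gen (A : pzRingType) (S : set A) : {pred A} :=
  mem (ideal_gen S).

HB.instance Definition _ (A : pzRingType) (S : set A) :=
  GRing.isZmodClosed.Build A (@in_ideal_gen A S)
  (two_sided_ideal_zmod_closed (ideal_gen_ideal S)).
HB.instance Definition _ (A : pzRingType) (S : set A) :=
  isTwoSided.Build A (@in_ideal_gen A S)
  (two_sided_ideal_mull (ideal_gen_ideal S))
  (two_sided_ideal_mulr (ideal_gen_ideal S)).

Definition in_jacobson (A : pzRingType) : {pred A} := mem (jacobson_radical A).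
Arguments in_jacobson A : clear implicits.
HB.instance Definition _ (A : pzRingType) :=
  GRing.isZmodClosed.Build A (in_jacobson A)
  (two_sided_ideal_zmod_closed (jacobson_radical_ideal A)).
HB.instance Definition _ (A : pzRingType) :=
  isTwoSided.Build A (in_jacobson A)
  (two_sided_ideal_mull (jacobson_radical_ideal A))
  (two_sided_ideal_mulr (jacobson_radical_ideal A)).

(* The additive group [{ideal_quot I}] is the library's; the library makes it a
   ring only when the ring is commutative. *)
Section QuotientRing.
Variables (A : pzRingType) (I : tsIdealType A).
Local Notation Q := {ideal_quot I}.

Definition qone : Q := lift_cst Q 1.
Definition qmul := lift_op2 Q *%R.

Canonical pi_qone_morph := PiConst qone.

Lemma repr_piB (x : A) : x - repr (\pi_Q x) \in I.
Proof. by rewrite Quotient.idealrBE reprK. Qed.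

Lemma pi_qmul : {morph \pi : x y / x * y >-> qmul x y}.
Proof.
move=> x y; unlock qmul; apply/eqP; rewrite -Quotient.idealrBE.
move: (repr_piB x) (repr_piB y).
set x' := repr _; set y' := repr _ => Ix Iy.
have -> : x * y - x' * y' = (x - x') * y + x' * (y - y').
  by rewrite mulrBl mulrBr addrA subrK.
by apply: rpredD; [apply: ideal_mulr | apply: ideal_mull].
Qed.
Canonical pi_qmul_morph := PiMorph2 pi_qmul.

Fact qmulA : associative qmul.
Proof. by move=> u v w; rewrite -[u]reprK -[v]reprK -[w]reprK !piE mulrA. Qed.

Fact qmul1l : left_id qone qmul.
Proof. by move=> u; rewrite -[u]reprK !piE mul1r. Qed.

Fact qmul1r : right_id qone qmul.
Proof. by move=> u; rewrite -[u]reprK !piE mulr1. Qed.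

Fact qmulDl : left_distributive qmul +%R.
Proof. by move=> u v w; rewrite -[u]reprK -[v]reprK -[w]reprK !piE mulrDl. Qed.

Fact qmulDr : right_distributive qmul +%R.
Proof. by move=> u v w; rewrite -[u]reprK -[v]reprK -[w]reprK !piE mulrDr. Qed.

Definition ring_quot : Type := Q.
HB.instance Definition _ := EqQuotient.on ring_quot.
HB.instance Definition _ := GRing.Zmodule.on ring_quot.
HB.instance Definition _ := GRing.Zmodule_isPzRing.Build ring_quot
  qmulA qmul1l qmul1r qmulDl qmulDr.

Definition quot_proj : A -> ring_quot := \pi_ring_quot.

Fact quot_proj_zmod_morphism : zmod_morphism quot_proj.
Proof. exact: (raddfB (\pi_Q)). Qed.
HB.instance Definition _ :=
  GRing.isZmodMorphism.Build A ring_quot quot_proj quot_proj_zmod_morphism.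

Fact quot_proj_monoid_morphism : monoid_morphism quot_proj.
Proof. by split=> [|x y]; rewrite /quot_proj !piE. Qed.
HB.instance Definition _ :=
  GRing.isMonoidMorphism.Build A ring_quot quot_proj quot_proj_monoid_morphism.

Lemma quot_proj_eq0 x : (quot_proj x == 0) = (x \in I).
Proof.
by rewrite -(rmorph0 quot_proj) /quot_proj -[LHS]Quotient.idealrBE subr0.
Qed.

Lemma quot_projK : cancel repr quot_proj.
Proof. exact: reprK. Qed.

End QuotientRing.

Section QuotientScaling.
Variables (k : pzRingType) (V : lmodType k) (I : zmodClosed V).
Hypothesis IZ : GRing.scaler_closed I.
Local Notation Q := {ideal_quot I}.

Definition qscale (a : k) : Q -> Q := lift_op1 Q (fun x : V => a *: x).

Lemma pi_qscale a : {morph \pi : x / a *: x >-> qscale a x}.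
Proof.
move=> x; unlock qscale; apply/eqP.
rewrite -Quotient.idealrBE -scalerBr; apply: IZ.
by rewrite Quotient.idealrBE reprK.
Qed.
Canonical pi_qscale_morph a := PiMorph1 (pi_qscale a).

Fact qscaleA a b u : qscale a (qscale b u) = qscale (a * b) u.
Proof. by rewrite -[u]reprK !piE scalerA. Qed.

Fact qscale1 : left_id 1 qscale.
Proof. by move=> u; rewrite -[u]reprK !piE scale1r. Qed.

Fact qscaleDr : right_distributive qscale +%R.
Proof. by move=> a u v; rewrite -[u]reprK -[v]reprK !piE scalerDr. Qed.

Fact qscaleDl u : {morph qscale^~ u : a b / a + b}.
Proof. by move=> a b; rewrite -[u]reprK !piE scalerDl. Qed.

Definition quot_lmod_mixin :=
  GRing.Zmodule_isLmodule.Build k Q qscaleA qscale1 qscaleDr qscaleDl.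

End QuotientScaling.

Lemma malg_scalerAr (K : monomType) (R : comNzRingType) (a : R)
    (u v : {malg R[K]}) : a *: (u * v) = u * (a *: v).
Proof.
apply/malgP=> m; rewrite mcoeffZ mcoeffMl mulr_sumr.
rewrite (mcoeffMlw m (finmap.fsubset_refl _) (msuppZ_le a v)).
apply: eq_bigr => m1 _; rewrite mulr_sumr; apply: eq_bigr => m2 _.
by rewrite mcoeffZ mulrnAr mulrCA.
Qed.

Section JordanPlane.
Variable k : fieldType.

(* k<x, y> is the algebra of the free monoid on two letters. *)
Definition free_algebra2 : Type := {malg k[{fmonom 'I_2}]}.
HB.instance Definition _ := GRing.Lalgebra.on free_algebra2.
HB.instance Definition _ := GRing.LSemiAlgebra_isSemiAlgebra.Build k
  free_algebra2 (@malg_scalerAr {fmonom 'I_2} k).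

Definition free_x : free_algebra2 := << fmu (0 : 'I_2) >>.
Definition free_y : free_algebra2 := << fmu (1 : 'I_2) >>.

Definition jordan_relation : free_algebra2 :=
  free_x * free_y - free_y * free_x - free_y ^+ 2.

Definition jordan_ideal : {pred free_algebra2} :=
  in_ideal_gen [set jordan_relation].
HB.instance Definition _ := TwoSidedIdeal.on jordan_ideal.

Definition jordan_plane : Type := ring_quot jordan_ideal.
HB.instance Definition _ := GRing.PzRing.on jordan_plane.
HB.instance Definition _ := EqQuotient.on jordan_plane.

Fact jordan_ideal_scaler_closed : GRing.scaler_closed jordan_ideal.
Proof. by move=> a u Iu; rewrite -mulr_algl ideal_mull. Qed.

HB.instance Definition _ : GRing.Zmodule_isLmodule k jordan_plane :=
  quot_lmod_mixin jordan_ideal_scaler_closed.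

Definition jordan_proj : free_algebra2 -> jordan_plane := quot_proj jordan_ideal.
HB.instance Definition _ := GRing.RMorphism.on jordan_proj.

Fact jordan_proj_scalable : scalable jordan_proj.
Proof. exact: (pi_qscale jordan_ideal_scaler_closed). Qed.
HB.instance Definition _ := GRing.isScalable.Build k free_algebra2 jordan_plane
  *:%R jordan_proj jordan_proj_scalable.

Lemma jordan_projK : cancel (repr : jordan_plane -> free_algebra2) jordan_proj.
Proof. exact: reprK. Qed.

Fact jordan_ideal1 : 1 \notin jordan_ideal.
Proof.
have [e [e1 eB eM] [ex ey]] : exists2 e : free_algebra2 -> k,
    [/\ e 1 = 1, {morph e : u v / u - v} & {morph e : u v / u * v}] &
    e free_x = 0 /\ e free_y = 0.
  pose e : {rmorphism {malg k[{fmonom 'I_2}]} -> k} :=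
    @mcoeff {fmonom 'I_2} k mone.
  exists e; first by split; [exact: rmorph1 | exact: rmorphB | exact: rmorphM].
  by split; rewrite /e /= mcoeffU -val_eqE /= fmU fm1.
have eN0 : e 0 = 0 by rewrite -(subrr 0) eB subrr.
have eD u v : e (u + v) = e u + e v.
  by rewrite -[v in LHS]opprK eB -[- v]sub0r eB eN0 sub0r opprK.
have eI : two_sided_ideal [set u | e u = 0].
  split; first split=> //=.
  - by move=> u v eu ev; rewrite eD eu ev addr0.
  - by move=> a u eu; rewrite eM eu mulr0.
  - by move=> a u /= eu; rewrite eM eu mul0r.
have eR u v : e u = 0 -> e v = 0 -> e (u * v - v * u - v * v) = 0.
  by move=> eu ev; rewrite !eB !eM eu ev mulr0 !subr0.
have {}eR : [set jordan_relation] `<=` [set u | e u = 0].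
  by move=> _ ->; apply: eR.
apply/negP; rewrite inE => /(_ _ (conj eI eR)) /= /eqP.
by rewrite e1 oner_eq0.
Qed.

Fact jordan_nonzero : (1 : jordan_plane) != 0.
Proof.
rewrite -(rmorph1 jordan_proj) [X in ~~ X](quot_proj_eq0 jordan_ideal).
exact: jordan_ideal1.
Qed.

HB.instance Definition _ :=
  GRing.PzSemiRing_isNonZero.Build jordan_plane jordan_nonzero.

Fact jordan_scalerAl (a : k) (u v : jordan_plane) : a *: (u * v) = a *: u * v.
Proof.
rewrite -[u]jordan_projK -[v]jordan_projK -rmorphM -!linearZ.
by rewrite scalerAl rmorphM.
Qed.

Fact jordan_scalerAr (a : k) (u v : jordan_plane) :
  a *: (u * v) = u * (a *: v).
Proof.
rewrite -[u]jordan_projK -[v]jordan_projK -rmorphM -!linearZ.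
by rewrite scalerAr rmorphM.
Qed.

HB.instance Definition _ :=
  GRing.LSemiModule_isLSemiAlgebra.Build k jordan_plane jordan_scalerAl.
HB.instance Definition _ :=
  GRing.LSemiAlgebra_isSemiAlgebra.Build k jordan_plane jordan_scalerAr.

Definition jordan_x : jordan_plane := jordan_proj free_x.
Definition jordan_y : jordan_plane := jordan_proj free_y.

End JordanPlane.

Arguments jordan_ideal k : clear implicits.
Arguments jordan_x {k}.
Arguments jordan_y {k}.

Section ImageAlgebra.
Variables (k : fieldType) (R : algType k) (n : nat).
Variable rho : {lrmorphism R -> 'M[k]_n}.

Definition rep_image : {pred 'M[k]_n} := mem (range rho).

Fact rep_image_subring_closed : subring_closed rep_image.
Proof.
split=> [|M N|M N]; rewrite !inE; first by exists 1; rewrite ?rmorph1.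
  by move=> [u _ <-] [v _ <-]; exists (u - v); rewrite ?rmorphB.
by move=> [u _ <-] [v _ <-]; exists (u * v); rewrite ?rmorphM.
Qed.

Fact rep_image_scaler_closed : GRing.scaler_closed rep_image.
Proof.
by move=> a M; rewrite !inE => -[u _ <-]; exists (a *: u); rewrite ?linearZ.
Qed.

HB.instance Definition _ :=
  GRing.isSubringClosed.Build _ rep_image rep_image_subring_closed.
HB.instance Definition _ :=
  GRing.isScaleClosed.Build k _ rep_image rep_image_scaler_closed.

Record rep_alg : predArgType := RepAlg {
  rep_mx :> 'M[k]_n;
  _ : rep_mx \in rep_image
}.

HB.instance Definition _ := [isSub for rep_mx].
HB.instance Definition _ := [Choice of rep_alg by <:].
HB.instance Definition _ := [SubChoice_isSubZmodule of rep_alg by <:].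
HB.instance Definition _ := 
  GRing.SubZmodule_isSubPzRing.Build _ _ rep_alg (GRing.subringClosedP _).
HB.instance Definition _ := [SubZmodule_isSubLmodule of rep_alg by <:].

Fact rep_alg_scalerAl (a : k) (u v : rep_alg) : a *: (u * v) = a *: u * v.
Proof. by apply: val_inj; rewrite /= scalemxAl. Qed.

Definition radical : {pred rep_alg} := in_jacobson rep_alg.
HB.instance Definition _ := TwoSidedIdeal.on radical.

Fact radical_scaler_closed : GRing.scaler_closed radical.
Proof.
by move=> a u Iu; rewrite -[u]mul1r rep_alg_scalerAl ideal_mull.
Qed.

Definition semisimple_part : Type := ring_quot radical.
HB.instance Definition _ := GRing.PzRing.on semisimple_part.
HB.instance Definition _ := EqQuotient.on semisimple_part.
HB.instance Definition _ : GRing.Zmodule_isLmodule k semisimple_part :=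
  quot_lmod_mixin radical_scaler_closed.

Definition semisimple_proj : rep_alg -> semisimple_part := quot_proj radical.
HB.instance Definition _ := GRing.RMorphism.on semisimple_proj.

Fact semisimple_proj_scalable : scalable semisimple_proj.
Proof. exact: (pi_qscale radical_scaler_closed). Qed.
HB.instance Definition _ := GRing.isScalable.Build k rep_alg semisimple_part
  *:%R semisimple_proj semisimple_proj_scalable.

Lemma semisimple_projK :
  cancel (repr : semisimple_part -> rep_alg) semisimple_proj.
Proof. exact: reprK. Qed.

End ImageAlgebra.

Arguments rep_image {k R n} rho.
Arguments radical {k R n} rho.

(* Main.v *)
Require Import Defs.
From mathcomp Require Import all_boot all_order all_algebra.
From HB Require Import structures.
From mathcomp Require Import boolp classical_sets.
From mathcomp.multinomials Require Import monalg.

Set Implicit Arguments.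
Unset Strict Implicit.
Unset Printing Implicit Defensive.

Import GRing.Theory.
Local Open Scope ring_scope.

(** Write [x], [y] for the generators, so that [x * y - y * x = y ^+ 2], and
    [X], [Y] for their images in [A].

    The commutator with [x] acts on polynomials in [y] as the derivation
    [y ^+ 2 * d/dy] ([jordan_comm_horner]).  Hence, if [p] annihilates [Y], so
    does ['X ^+ 2 * p^`()]; in characteristic 0, differentiating [p] down to a
    nonzero constant in this way shows that a power of [Y] vanishes
    ([jordan_nilpotent]).

    The relation also reads [y * x = (x - y) * y], so the left ideal generated
    by [y] is two-sided and every element is [p(x) + v * y] for a polynomial
    [p] ([jordan_plane_normal_form]).  Thus [A = k[X] + A Y], where [A Y] is an
    ideal whose elements are nilpotent.

    Let [a] be an eigenvalue of [X].  The map [p(X) + B Y |-> p(a)] is a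
    character of [A]: it is well defined because [p(X)] in [A Y] is nilpotent,
    which forces [p(a) = 0] on an eigenvector ([zero_reduces_to_root]).
    Together these characters map [A] onto the product of copies of [k]
    indexed by the eigenvalues, by interpolation.  The kernel contains the
    Jacobson radical, since each character has a maximal kernel.  Conversely,
    if [p] vanishes at all eigenvalues, then a power of [p] is a multiple of
    the characteristic polynomial of [X], so a power of [p(X) + B Y] falls into
    [A Y] by the Cayley-Hamilton theorem.  The kernel is therefore a nil ideal,
    and is contained in the radical. *)

(** * The Jacobson radical between nil ideals and characters *)

Section MaximalLeftIdeals.
Variable A : pzRingType.
Local Open Scope classical_set_scope.

(** If an element [u] of [K] were outside a maximal left ideal [M], then
    [M + A u] would contain 1, so [1 - a * u] would be in [M] for some [a]; it
    is a unit because [a * u], which lies in [K], is nilpotent. *)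
Lemma nil_left_ideal_sub_jacobson (K : set A) :
  left_ideal K -> (forall u, K u -> exists m, u ^+ m = 0) ->
  K `<=` jacobson_radical A.
Proof.
move=> [K0 KD KM] Knil u Ku M [LM MT Mmax]; have [M0 MD MM] := LM.
have [//|Mu] := pselect (M u); exfalso.
pose N := [set z | exists a, M (z - a * u)].
have LN : left_ideal N.
  split=> [|z t [a Ma] [b Mb]|c z [a Ma]].
  - by exists 0; rewrite mul0r subr0.
  - by exists (a + b); rewrite mulrDl opprD addrACA; apply: MD.
  - by exists (c * a); rewrite -mulrA -mulrBr; apply: MM.
have MN : M `<=` N by move=> z Mz; exists 0; rewrite mul0r subr0.
have [NM|NT] := Mmax _ LN MN.
  by apply: Mu; rewrite -NM; exists 1; rewrite mul1r subrr.
have [a M1au] : N 1 by rewrite NT.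
have [m aum] := Knil _ (KM a _ Ku).
apply: MT; apply: left_ideal1 => //.
(* [1 - w] is a right factor of [1 - w ^+ j] for every [j]. *)
suff M1pow j : M (1 - (a * u) ^+ j) by have := M1pow m; rewrite aum subr0.
elim: j => [|j IHj]; first by rewrite expr0 subrr.
have -> : 1 - (a * u) ^+ j.+1 = (1 - a * u) + a * u * (1 - (a * u) ^+ j).
  by rewrite mulrBr mulr1 addrA subrK exprS.
by apply: MD => //; apply: MM.
Qed.

(** The kernel is a maximal left ideal: once an element [b] with [h b != 0] is
    added to it, it contains [1 - c * b] with [h c = (h b)^-1], hence 1. *)
Lemma jacobson_sub_ker (k : fieldType) (h : {rmorphism A -> k}) :
  (forall c, exists u, h u = c) -> forall u, jacobson_radical A u -> h u = 0.
Proof.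
move=> h_surj; suff maxker : maximal_left_ideal [set u | h u = 0].
  by move=> u /(_ _ maxker).
split=> [|E|N [_ ND NM] kerN].
- split=> /= [|z t hz ht|a z hz]; first exact: rmorph0.
    by rewrite rmorphD hz ht addr0.
  by rewrite rmorphM hz mulr0.
- have : [set u | h u = 0] 1 by rewrite E.
  by move/eqP; rewrite /= rmorph1 oner_eq0.
have [NE|/existsNP[b /not_implyP[Nb /eqP hb]]] :=
    pselect (forall b, N b -> h b = 0).
  by left; apply/seteqP; split.
right; apply/left_ideal1; first by split=> //; apply: kerN; apply: rmorph0.
have [c hc] := h_surj (h b)^-1.
rewrite -[1](subrK (c * b)); apply: ND; last exact: NM.
by apply: kerN; rewrite /= rmorphB rmorphM rmorph1 hc mulVf // subrr.
Qed.

End MaximalLeftIdeals.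

Section QuotientMaps.
Variables (A B : pzRingType) (I : tsIdealType A) (g : {rmorphism A -> B}).

(** First isomorphism theorem.  The map is described on projections, so that
    further properties of [g], such as linearity, can be transported. *)
Lemma ring_quot_iso :
  (forall u, (u \in I) = (g u == 0)) -> (forall b, exists u, g u = b) ->
  exists f : {rmorphism ring_quot I -> B},
    bijective f /\ forall u, f (quot_proj I u) = g u.
Proof.
move=> gI g_surj.
pose f (q : ring_quot I) : B := g (repr q).
have fE u : f (quot_proj I u) = g u.
  apply/eqP; rewrite -subr_eq0 -rmorphB -gI -(quot_proj_eq0 I) rmorphB.
  by rewrite /= quot_projK subrr.
have fB : zmod_morphism f.
  move=> u v; rewrite -[u]quot_projK -[v]quot_projK -rmorphB !fE.
  exact: rmorphB.
have fM : monoid_morphism f.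
  split=> [|u v]; first by rewrite -(rmorph1 (quot_proj I)) fE rmorph1.
  by rewrite -[u]quot_projK -[v]quot_projK -rmorphM !fE rmorphM.
pose f_add := GRing.isZmodMorphism.Build _ _ f fB.
pose f_mul := GRing.isMonoidMorphism.Build _ _ f fM.
pose fR : {rmorphism ring_quot I -> B} := HB.pack f f_add f_mul.
exists fR; split=> //.
have [h hK] := choice g_surj.
exists (fun b => quot_proj I (h b)) => [q|b]; last by rewrite /= fE hK.
apply/eqP; rewrite -subr_eq0 -{2}[q]quot_projK -rmorphB quot_proj_eq0 gI.
by rewrite rmorphB hK subrr.
Qed.

End QuotientMaps.

(** * Two facts on polynomials *)

Lemma interpolation (F : fieldType) (s : seq F) (v : 'I_(size s) -> F) :
  uniq s -> exists p : {poly F}, forall i : 'I_(size s), p.[s`_i] = v i.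
Proof.
move=> Us.
pose L (i : 'I_(size s)) := \prod_(j | j != i) ('X - (s`_j)%:P).
have Ls i j : i != j -> (L i).[s`_j] = 0.
  move=> ij; rewrite horner_prod (bigD1 j) 1?eq_sym //=.
  by rewrite hornerXsubC subrr mul0r.
have Li i : (L i).[s`_i] != 0.
  rewrite horner_prod; apply/prodf_neq0 => j ji.
  by rewrite hornerXsubC subr_eq0 nth_uniq // eq_sym.
exists (\sum_i (v i / (L i).[s`_i]) *: L i) => i.
rewrite horner_sum (bigD1 i) //= hornerZ divfK // big1 ?addr0 // => j ji.
by rewrite hornerZ (Ls j i) ?mulr0.
Qed.

(** Repeated roots are allowed in [r], whence the power of [p]. *)
Lemma exp_multiple_prod_XsubC (F : fieldType) (r : seq F) (p : {poly F}) :
  (forall a, a \in r -> root p a) ->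
  exists q, p ^+ size r = q * \prod_(a <- r) ('X - a%:P).
Proof.
elim: r => [|a r IHr] r_roots; first by exists 1; rewrite big_nil mulr1.
have [|q qE] := IHr; first by move=> b br; apply: r_roots; rewrite inE br orbT.
have /factor_theorem[q' pE] := r_roots a (mem_head a r).
by exists (q' * q); rewrite big_cons exprS qE {1}pE mulrACA.
Qed.

(** * Consequences of the relation of the Jordan plane *)

Section JordanRelation.
Variables (k : fieldType) (R : algType k) (x y : R).
Hypothesis jordanE : x * y - y * x = y ^+ 2.

Let xyE : x * y = y * x + y ^+ 2.
Proof. by rewrite -jordanE addrC subrK. Qed.
Let yxE : y * x = (x - y) * y.
Proof. by rewrite mulrBl xyE expr2 addrK. Qed.

(** The commutator with [x] is a derivation that sends [y] to [y ^+ 2]. *)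
Lemma jordan_comm_horner p :
  x * horner_alg y p - horner_alg y p * x = horner_alg y ('X ^+ 2 * p^`()).
Proof.
elim/poly_ind: p => [|p c IHp].
  by rewrite deriv0 mulr0 !rmorph0 mulr0 mul0r subrr.
have comm_mul_y (u : R) :
    x * (u * y) - u * y * x = (x * u - u * x) * y + u * y ^+ 2.
  by rewrite -jordanE mulrBl mulrBr !mulrA addrA subrK.
have -> : 'X^2 * (p * 'X + c%:P)^`() = 'X^2 * p^`() * 'X + p * 'X^2.
  by rewrite derivD derivM derivX derivC addr0 mulr1 mulrDr mulrA [p * _]mulrC.
rewrite !rmorphD !rmorphM /= !horner_algX horner_algC in IHp *.
rewrite mulrDr mulrDl -scalerAr -scalerAl mulr1 mul1r opprD addrACA subrr addr0.
by rewrite comm_mul_y IHp expr2.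
Qed.

(** Since [y * x = (x - y) * y], the factor [v] is [p(x - y)]. *)
Lemma y_mul_horner_x p : exists v, y * horner_alg x p = v * y.
Proof.
elim/poly_ind: p => [|p c [v yp]].
  by exists 0; rewrite rmorph0 mulr0 mul0r.
exists (v * (x - y) + c%:A).
rewrite rmorphD rmorphM /= horner_algX horner_algC mulrDr mulrA yp -mulrA yxE.
by rewrite mulrA -scalerAr mulr1 mulrDl -scalerAl mul1r.
Qed.

Section Nilpotent.
Variables (S : pzRingType) (rho : {rmorphism R -> S}).
Hypothesis k_pchar0 : [pchar k] =i pred0.

Lemma jordan_ann_deriv q :
  rho (horner_alg y q) = 0 -> rho (horner_alg y ('X ^+ 2 * q^`())) = 0.
Proof.
by move=> q0; rewrite -jordan_comm_horner rmorphB !rmorphM q0 mulr0 mul0r subrr.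
Qed.

(** If [y ^+ j * p(y)] is killed by [rho], then so is its commutator with [x],
    which is [y ^+ j.+2 * p'(y)] up to the multiple
    [j * y ^+ j.+1 * p(y)] of the same element.  Each such step lowers the
    degree of [p] by one without making it zero, in characteristic 0, and ends
    with a nonzero constant times a power of [y]. *)
Lemma jordan_nilpotent p :
  p != 0 -> rho (horner_alg y p) = 0 -> exists m, rho y ^+ m = 0.
Proof.
suff H j : p != 0 -> rho (horner_alg y ('X^j * p)) = 0 ->
    exists m, rho y ^+ m = 0.
  by move=> p0 yp; apply: (H 0%N); rewrite ?mul1r.
have [d] := ubnP (size p); elim: d p j => // d IHd p j ltpd p0 yp.
have ann r q : rho (horner_alg y q) = 0 -> rho (horner_alg y (r * q)) = 0.
  by move=> q0; rewrite !rmorphM q0 mulr0.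
have [sp1|sp_gt1] := leqP (size p) 1.
  have pE := size1_polyC sp1; exists j.
  rewrite -[y](horner_algX (R := k)) -!rmorphXn /=.
  have p00 : p`_0 != 0 by apply: contraNneq p0 => p00; rewrite pE p00.
  have -> : 'X^j = (p`_0)^-1%:P * ('X^j * p).
    by rewrite {2}pE mulrCA -polyCM mulVf ?mulr1.
  exact: ann.
have p'0 : p^`() != 0.
  have [d' dE] : exists d', size p = d'.+2.
    by case: (size p) sp_gt1 => [|[|d']] // _; exists d'.
  apply: contraNneq p0 => /(congr1 (fun q : {poly k} => q`_d')) /eqP.
  rewrite coef_deriv coef0 -mulr_natr mulf_eq0 -lead_coef_eq0 lead_coefE dE /=.
  by move/pcharf0P: k_pchar0 => ->; rewrite orbF.
apply: (IHd p^`() j.+2) => //.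
  by rewrite (leq_trans (lt_size_deriv p0)) // -ltnS.
have X2 : 'X^2 * ('X^j)^`() = j%:R * 'X * 'X^j :> {poly k}.
  case: (j) => [|i]; first by rewrite derivXn mulr0n mulr0 !mul0r.
  by rewrite derivXn -mulr_natl mulrCA -exprD -mulrA -exprS.
have -> : 'X^(j.+2) * p^`() = 'X^2 * ('X^j * p)^`() - j%:R * 'X * ('X^j * p).
  rewrite derivM mulrDr 2!mulrA X2 -(mulrA (_ * 'X)) addrAC subrr add0r.
  by rewrite -exprD.
by rewrite !rmorphB /= (ann _ _ yp) jordan_ann_deriv ?subrr.
Qed.

End Nilpotent.

End JordanRelation.

Lemma normal_mul_exp (R : pzRingType) (y : R) :
  (forall u, exists v, y * u = v * y) ->
  forall u m, exists v, (u * y) ^+ m = v * y ^+ m.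
Proof.
move=> yN u; elim=> [|m [v IHm]]; first by exists 1; rewrite !expr0 mulr1.
have [w yw] := yN v; exists (u * w).
by rewrite exprS IHm -mulrA (mulrA y) yw -mulrA -exprS mulrA.
Qed.

(** * Normal form in the Jordan plane *)

Section JordanPlaneNormalForm.
Variable k : fieldType.
Local Notation x := (jordan_x : jordan_plane k).
Local Notation y := (jordan_y : jordan_plane k).

Lemma jordan_planeE : x * y - y * x = y ^+ 2.
Proof.
apply/eqP; rewrite -subr_eq0 -rmorphXn -!rmorphM -!rmorphB.
rewrite [X in is_true X]quot_proj_eq0 inE => I [_]; exact.
Qed.

Let normal_form u := exists p v, u = horner_alg x p + v * y.

(** The set of these sums is a subspace that contains 1 and is stable under
    left multiplication by [x] and by [y], hence contains every word in the
    two letters. *)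
Lemma jordan_plane_normal_form u : normal_form u.
Proof.
have nfD u1 u2 : normal_form u1 -> normal_form u2 -> normal_form (u1 + u2).
  move=> [p [v ->]] [q [w ->]]; exists (p + q), (v + w).
  by rewrite rmorphD mulrDl addrACA.
have nfZ c u1 : normal_form u1 -> normal_form (c *: u1).
  move=> [p [v ->]]; exists (c *: p), (c *: v).
  by rewrite linearZ /= mulr_algl scalerDr scalerAl.
have nf0 : normal_form 0 by exists 0, 0; rewrite rmorph0 mul0r addr0.
have nfx u1 : normal_form u1 -> normal_form (x * u1).
  move=> [p [v ->]]; exists ('X * p), (x * v).
  by rewrite rmorphM /= horner_algX mulrDr mulrA.
have nfy u1 : normal_form u1 -> normal_form (y * u1).
  move=> [p [v ->]]; have [w yp] := y_mul_horner_x jordan_planeE p.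
  by exists 0, (w + y * v); rewrite rmorph0 add0r mulrDr yp mulrDl mulrA.
rewrite -[u]jordan_projK; move: (repr u : free_algebra2 k) => {u} w.
rewrite [w]monalgE (raddf_sum (@jordan_proj k)).
elim/big_rec: _ => // m u _ nfu; apply: nfD => //.
have -> : << w@_m *g m >> = w@_m *: (<< m >> : free_algebra2 k).
  by apply/malgP => m'; rewrite mcoeffZ !mcoeffU mulr_natr.
rewrite /= jordan_proj_scalable; apply: nfZ.
case: m => t; elim: t => [|i t IHt].
  exists 1, 0; rewrite rmorph1 mul0r addr0.
  by rewrite -(rmorph1 (@jordan_proj k)); congr jordan_proj; rewrite -fmoneE.
have -> : << FMonom (i :: t) >>
    = << fmu i >> * (<< FMonom t >> : free_algebra2 k).
  rewrite malgM_def fgmulUU mulr1; congr << _ >>.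
  by apply: val_inj; rewrite /= fmM fmU.
rewrite rmorphM; case: i => [[|[|//]] lti].
  by rewrite (_ : Ordinal lti = 0); [apply: nfx | apply: val_inj].
by rewrite (_ : Ordinal lti = 1); [apply: nfy | apply: val_inj].
Qed.

End JordanPlaneNormalForm.

(** * Polynomials under a matrix representation *)

Section MatrixRepresentation.
Variables (k : fieldType) (R : algType k) (n : nat).
Variable rho : {lrmorphism R -> 'M[k]_n}.

(** Evaluation takes place in [R], where it makes sense even for [n = 0]. *)
Lemma rep_char_poly u : rho (horner_alg u (char_poly (rho u))) = 0.
Proof.
case: n rho => [|m] r; first exact: flatmx0.
rewrite -[RHS](Cayley_Hamilton (r u)); move: (char_poly _) => p.
elim/poly_ind: p => [|p c IHp]; first by rewrite !rmorph0.
rewrite !rmorphD !rmorphM /= IHp horner_algX horner_mx_X horner_algC.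
by rewrite linearZ /= rmorph1 horner_mx_C -scalemx1.
Qed.

Lemma rep_mul_char_poly u r : rho (horner_alg u (r * char_poly (rho u))) = 0.
Proof. by rewrite !rmorphM /= rep_char_poly mulr0. Qed.

Lemma eigenvector_horner u a (v : 'rV_n) p :
  v *m rho u = a *: v -> v *m rho (horner_alg u p) = p.[a] *: v.
Proof.
move=> va; elim/poly_ind: p => [|p c IHp].
  by rewrite !rmorph0 horner0 mulmx0 scale0r.
rewrite !rmorphD !rmorphM /= horner_algX horner_algC mulmxDr.
rewrite -[rho _ * rho u]/(rho _ *m rho u) mulmxA IHp -scalemxAl va scalerA.
by rewrite linearZ /= rmorph1 -scalemxAr mulmx1 !hornerE scalerDl.
Qed.

End MatrixRepresentation.

(** * The characters of the image algebra *)

(** The relation and the normal form together say that [R] is a quotient of the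
    Jordan plane. *)
Section SpectralCharacters.
Variables (k : closedFieldType) (n : nat).
Hypothesis k_pchar0 : [pchar k] =i pred0.
Variables (R : algType k) (x y : R).
Hypothesis jordanE : x * y - y * x = y ^+ 2.
Hypothesis R_normal_form : forall u, exists p v, u = horner_alg x p + v * y.
Variable rho : {lrmorphism R -> 'M[k]_n}.
Local Notation A := (rep_alg rho).
Implicit Types (M N : A) (p q : {poly k}) (a : k).

Let y_normal u : exists v, y * u = v * y.
Proof.
have [p [v ->]] := R_normal_form u.
have [w yp] := y_mul_horner_x jordanE p.
by exists (w + y * v); rewrite mulrDr yp mulrDl mulrA.
Qed.

(** Congruence of [M] to [p(X)] modulo the ideal generated by [Y].  It is a
    relation because [M] determines only the values of [p] at the eigenvalues
    of [X]. *)
Definition reduces_to M p := exists v, rep_mx M = rho (horner_alg x p + v * y).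

Lemma reduces_to_ex M : exists p, reduces_to M p.
Proof.
have /set_mem[u _ uM] := valP M; have [p [v uE]] := R_normal_form u.
by exists p, v; rewrite -uE uM.
Qed.

Lemma poly_reduces_to p : exists M, reduces_to M p.
Proof.
have xpA : rho (horner_alg x p) \in rep_image rho.
  by rewrite inE; exists (horner_alg x p).
by exists (RepAlg xpA), 0; rewrite mul0r addr0.
Qed.

Lemma reduces_to1 : reduces_to 1 1.
Proof. by exists 0; rewrite rmorph1 mul0r addr0 !rmorph1. Qed.

Lemma reduces_toB M N p q :
  reduces_to M p -> reduces_to N q -> reduces_to (M - N) (p - q).
Proof.
move=> [v vE] [w wE]; exists (v - w).
have -> : rep_mx (M - N) = rep_mx M - rep_mx N by [].
rewrite vE wE -[LHS]rmorphB; congr (rho _).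
by rewrite rmorphB mulrBl opprD addrACA.
Qed.

Lemma reduces_toM M N p q :
  reduces_to M p -> reduces_to N q -> reduces_to (M * N) (p * q).
Proof.
move=> [v vE] [w wE]; have [t yt] := y_normal (horner_alg x q + w * y).
exists (horner_alg x p * w + v * t).
have -> : rep_mx (M * N) = rep_mx M * rep_mx N by [].
rewrite vE wE -[LHS]rmorphM; congr (rho _).
by rewrite rmorphM mulrDl -(mulrA v) yt mulrDr (mulrDl _ _ y) !mulrA addrA.
Qed.

Lemma reduces_toX M p m : reduces_to M p -> reduces_to (M ^+ m) (p ^+ m).
Proof.
move=> Mp; elim: m => [|m IHm]; first exact: reduces_to1.
by rewrite !exprS; apply: reduces_toM.
Qed.

Lemma reduces_toZ c M p : reduces_to M p -> reduces_to (c *: M) (c *: p).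
Proof.
move=> [v vE]; exists (c *: v).
have -> : rep_mx (c *: M) = c *: rep_mx M by [].
rewrite vE -[LHS]linearZ; congr (rho _).
by rewrite linearZ /= mulr_algl scalerDr scalerAl.
Qed.

Lemma rep_mxX M m : rep_mx (M ^+ m) = rep_mx M ^+ m.
Proof. by elim: m => // m IHm; rewrite !exprS -IHm. Qed.

Lemma rep_y_nilpotent : exists m, rho y ^+ m = 0.
Proof.
apply: (jordan_nilpotent jordanE k_pchar0 _ (rep_char_poly rho y)).
exact/monic_neq0/char_poly_monic.
Qed.

(** As [y] is normal, [(v * y) ^+ m] is a multiple of [y ^+ m]. *)
Lemma reduces_to0_nilpotent M : reduces_to M 0 -> exists m, M ^+ m = 0.
Proof.
move=> [v vE]; have [m ym] := rep_y_nilpotent; exists m; apply: val_inj.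
have [w vyE] := normal_mul_exp y_normal v m.
rewrite [LHS]rep_mxX vE rmorph0 add0r -rmorphXn vyE.
by rewrite rmorphM rmorphXn ym mulr0.
Qed.

(** Some power of [p] is a multiple of the characteristic polynomial of [X], so
    the same power of [M] lies in the nil ideal generated by [Y]. *)
Lemma reduces_to_nilpotent M p :
  reduces_to M p -> (forall a, eigenvalue (rho x) a -> root p a) ->
  exists m, M ^+ m = 0.
Proof.
move=> Mp p_roots.
have [d [r pdE]] : exists d r, p ^+ d = r * char_poly (rho x).
  have [r] := closed_field_poly_normal (char_poly (rho x)).
  rewrite (monicP (char_poly_monic _)) scale1r => cE; exists (size r).
  rewrite {1}cE; apply: exp_multiple_prod_XsubC => a ar.
  by apply: p_roots; rewrite eigenvalue_root_char cE root_prod_XsubC.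
have [|m Mdm] := @reduces_to0_nilpotent (M ^+ d).
  have pd0 : rho (horner_alg x (p ^+ d)) = 0 by rewrite pdE rep_mul_char_poly.
  have [w wE] := reduces_toX d Mp; exists w.
  by rewrite wE !rmorphD /= pd0 !rmorph0.
by exists (d * m)%N; rewrite exprM.
Qed.

(** This makes [p(a)] a function of [M]: here [p(X)] lies in the ideal
    generated by [Y], so it is nilpotent, while it acts as [p.[a]] on an
    eigenvector of [X]. *)
Lemma zero_reduces_to_root p a :
  reduces_to 0 p -> eigenvalue (rho x) a -> root p a.
Proof.
move=> [v vE] /eigenvalueP[z zX z0]; have [m ym] := rep_y_nilpotent.
have {}vE : rho (horner_alg x p) = rho (- v * y).
  by apply/eqP; rewrite mulNr rmorphN -addr_eq0 -rmorphD; apply/eqP.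
have [w vyE] := normal_mul_exp y_normal (- v) m.
have : rho (horner_alg x (p ^+ m)) = 0.
  by rewrite !rmorphXn /= vE -rmorphXn vyE rmorphM rmorphXn ym mulr0.
move=> pm0; have /esym/eqP := eigenvector_horner (p ^+ m) zX.
rewrite pm0 mulmx0 scaler_eq0 (negPf z0) orbF horner_exp expf_eq0.
by case/andP.
Qed.

(** The value at [a] of any [p] to which [M] reduces; the default of [xget] is
    never reached, by [reduces_to_ex]. *)
Definition spectral_value a M := (xget 0 (reduces_to M)).[a].

Lemma spectral_valueE a M p :
  eigenvalue (rho x) a -> reduces_to M p -> spectral_value a M = p.[a].
Proof.
move=> aX Mp; have [q Mq] := reduces_to_ex M.
apply/eqP; rewrite -subr_eq0 -hornerN -hornerD.
apply: zero_reduces_to_root => //; rewrite -(subrr M).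
by apply: reduces_toB => //; apply: (xgetI 0 Mq).
Qed.

Lemma spectral_character a : eigenvalue (rho x) a ->
  exists h : {rmorphism A -> k},
    [/\ h =1 spectral_value a, scalable (h : A -> k^o)
      & forall c, exists M, h M = c].
Proof.
move=> aX.
have fB : zmod_morphism (spectral_value a : A -> k).
  move=> M N; have [[p Mp] [q Nq]] := (reduces_to_ex M, reduces_to_ex N).
  rewrite (spectral_valueE aX Mp) (spectral_valueE aX Nq).
  by rewrite (spectral_valueE aX (reduces_toB Mp Nq)) hornerD hornerN.
have fM : monoid_morphism (spectral_value a : A -> k).
  split=> [|M N]; first by rewrite (spectral_valueE aX reduces_to1) hornerE.
  have [[p Mp] [q Nq]] := (reduces_to_ex M, reduces_to_ex N).
  rewrite (spectral_valueE aX Mp) (spectral_valueE aX Nq).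
  by rewrite (spectral_valueE aX (reduces_toM Mp Nq)) hornerM.
pose f_add := GRing.isZmodMorphism.Build _ _ _ fB.
pose f_mul := GRing.isMonoidMorphism.Build _ _ _ fM.
pose f : {rmorphism A -> k} := HB.pack (spectral_value a : A -> k) f_add f_mul.
exists f; split=> // [c M|c].
  have [p Mp] := reduces_to_ex M.
  rewrite /= (spectral_valueE aX Mp) (spectral_valueE aX (reduces_toZ c Mp)).
  exact: hornerZ.
have [M Mc] := poly_reduces_to c%:P; exists M.
by rewrite /= (spectral_valueE aX Mc) hornerC.
Qed.

Variable s : seq k.
Hypotheses (s_uniq : uniq s) (sX : forall a, (a \in s) = eigenvalue (rho x) a).

(** The kernel of the joint character map is the radical: the kernel is
    contained in the radical because it is a nil ideal, and contains the
    radical because every component is a character onto [k]. *)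
Lemma semisimple_part_iso :
  exists f : {rmorphism semisimple_part rho -> {ffun 'I_(size s) -> k^o}},
    scalable f /\ bijective f.
Proof.
have siX (i : 'I_(size s)) : eigenvalue (rho x) s`_i by rewrite -sX mem_nth.
have [h hP] := choice (fun i => spectral_character (siX i)).
pose g M : {ffun 'I_(size s) -> k^o} := [ffun i => h i M].
have gB : zmod_morphism g.
  by move=> M N; apply/ffunP => i; rewrite !ffunE rmorphB.
have gM : monoid_morphism g.
  by split=> [|M N]; apply/ffunP => i; rewrite !ffunE ?rmorph1 ?rmorphM.
pose g_add := GRing.isZmodMorphism.Build _ _ _ gB.
pose g_mul := GRing.isMonoidMorphism.Build _ _ _ gM.
pose gR : {rmorphism A -> {ffun 'I_(size s) -> k^o}} :=
  HB.pack g g_add g_mul.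
have g_eval M p i : reduces_to M p -> g M i = p.[s`_i].
  by move=> Mp; rewrite ffunE; have [-> _ _] := hP i; apply: spectral_valueE.
have g_surj b : exists M, gR M = b.
  have [p pE] := interpolation b s_uniq; have [M Mp] := poly_reduces_to p.
  by exists M; apply/ffunP => i; rewrite -pE; apply: g_eval.
have g_ker M : (M \in radical rho) = (gR M == 0).
  apply/idP/eqP => [|gM0].
    rewrite inE => JM; apply/ffunP => i; rewrite !ffunE.
    by have [_ _ h_surj] := hP i; apply: jacobson_sub_ker JM.
  rewrite inE; pose K := [set N | gR N = 0]%classic.
  apply: (nil_left_ideal_sub_jacobson (K := K)) => //.
    split=> [|N1 N2|N1 N2]; rewrite /K /mkset; first exact: rmorph0.
      by rewrite rmorphD => -> ->; rewrite addr0.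
    by rewrite rmorphM => ->; rewrite mulr0.
  move=> N /= gN0; have [p Np] := reduces_to_ex N.
  apply: (reduces_to_nilpotent Np) => a; rewrite -sX => /(nthP 0)[i lti <-].
  by rewrite /root -(g_eval _ _ (Ordinal lti) Np) [g N]gN0 ffunE.
have [f [f_bij fE]] := ring_quot_iso g_ker g_surj.
exists f; split=> // c u.
rewrite -[u]semisimple_projK -semisimple_proj_scalable !fE.
apply/ffunP => i; rewrite !ffunE.
by have [_ hZ _] := hP i; apply: hZ.
Qed.

End SpectralCharacters.

Theorem theorem2p10 (k : closedFieldType) (chark : [pchar k] =i pred0) (n : nat)
    (rho : {lrmorphism jordan_plane k -> 'M[k]_n}) :
  exists s : seq k,
    [/\ uniq s,
        forall a : k, (a \in s) = eigenvalue (rho jordan_x) a &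
        exists f : {rmorphism semisimple_part rho -> {ffun 'I_(size s) -> k^o}},
          scalable f /\ bijective f].
Proof.
have [r] := closed_field_poly_normal (char_poly (rho jordan_x)).
rewrite (monicP (char_poly_monic _)) scale1r => cE.
have sX a : (a \in undup r) = eigenvalue (rho jordan_x) a.
  by rewrite mem_undup eigenvalue_root_char cE root_prod_XsubC.
exists (undup r); split=> //; first exact: undup_uniq.
have s_uniq := undup_uniq r; move: sX; apply: semisimple_part_iso => //.
  exact: jordan_planeE.
exact: jordan_plane_normal_form.
Qed.
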